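(* Let $\mathcal{H}$ be a Hilbert space. For a complete family of subspaces $\{\mathcal{W}_i\}_{i\in I}$ of $\mathcal{H}$ and positive weights $\{v_i\}_{i\in I}$, the following conditions are equivalent. (i) $\{(\mathcal{W}_i,v_i)\}_{i\in I}$ is a Parseval fusion frame for $\mathcal{H}$. (ii) There exist a Hilbert space $\mathcal{K}\supset\mathcal{H}$, an orthonormal basis $\{e_j\}_{j\in J}$ for $\mathcal{K}$, a partition $\{J_i\}_{i\in I}$ of $J$, and isometries $L_i:\mathcal{E}_i:=\mathrm{span}\{e_j\}_{j\in J_i}\to\mathcal{W}_i$, $i\in I$, such that $$P=\sum_{i\in I}v_iL_i$$ is an orthogonal projection of $\mathcal{K}$ onto $\mathcal{H}$.
   Context: For a Hilbert space $\mathcal{H}$, a family of closed subspaces $\{\mathcal{W}_i\}_{i\in I}$ with associated positive weights $v_i$ is a fusion frame for $\mathcal{H}$, written $\{(\mathcal{W}_i,v_i)\}_{i\in I}$, if there are constants $0<A\le B<\infty$ with $A\|f\|^2\le\sum_{i\in I}v_i^2\|P_if\|^2\le B\|f\|^2$ for all $f\in\mathcal{H}$, where $P_i$ is the orthogonal projection onto $\mathcal{W}_i$. It is Parseval if $A=B=1$ can be chosen. A family of subspaces is called complete in $\mathcal{H}$ if their span equals $\mathcal{H}$. In the sum $\sum_{i\in I}v_iL_i$, each $L_i$ is regarded as an operator on $\mathcal{K}$ that is zero on the orthogonal complement of $\mathcal{E}_i$.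
   Formalization: The isometries L_i are taken to be linear and onto W_i; with isometries merely into W_i, (ii) does not imply (i) (H=K=R^2, W_1=span e_1, W_2=R^2, v_i=1, L_i the inclusions of span e_i). *)

(* Defs.v *)
From HB Require Import structures.
From mathcomp Require Import all_boot all_order all_algebra finmap.
From mathcomp Require Import sesquilinear.
From mathcomp Require Import boolp classical_sets functions reals topology normedtype.
From mathcomp.analysis.showcase Require Import summability.
From mathcomp.real_closed Require Import complex.

Set Implicit Arguments.
Unset Strict Implicit.
Unset Printing Implicit Defensive.

Import Order.TTheory GRing.Theory Num.Theory.
Import numFieldNormedType.Exports.

Local Open Scope classical_set_scope.
Local Open Scope ring_scope.
Local Open Scope complex_scope.

(* A Hilbert space is either real or complex. *)
Variant scalar_kind := RealScalars | ComplexScalars.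

Definition scalar_field (R : realType) (s : scalar_kind) : numFieldType :=
  match s with RealScalars => R | ComplexScalars => R[i] end.

Definition scalar_conj (R : realType) (s : scalar_kind) :
    {rmorphism scalar_field R s -> scalar_field R s} :=
  match s with RealScalars => idfun | ComplexScalars => @conjc R end.

(* The inner product is linear in its first argument and semilinear in the
   second one, and it induces the norm, for which the space is complete. *)
HB.mixin Record NormedModule_hasInner (F : numFieldType) (theta : F -> F) V
    of NormedModule F V := {
  inner : {dot V for theta} ;
  inner_norm : forall x : V, inner x x = `|x| ^+ 2
}.

#[short(type="hilbertType")]
HB.structure Definition Hilbert (F : numFieldType) (theta : F -> F) :=
  {V of CompleteNormedModule F V & NormedModule_hasInner F theta V}.

Arguments inner {F theta s}.

(* Unconditional convergence: the net of the finite partial sums converges. *)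
Definition has_sum (F : numFieldType) (V : normedModType F) (I : choiceType)
    (x : I -> V) (l : V) :=
  partial_sum x @ totally --> l.

Section Subspaces.
Context {F : numFieldType} {theta : F -> F}.
Implicit Types V : hilbertType theta.

Definition closed_subspace V (A : set V) := submod_closed (mem A) /\ closed A.

(* The closure of the linear span, i.e. of the least linear subspace that
   contains A. *)
Definition closed_span V (A : set V) : set V :=
  closure (smallest (fun M : set V => submod_closed (mem M)) A).

Definition complete_family V (I : Type) (W : I -> set V) :=
  closed_span (\bigcup_i W i) = setT.

Definition orthonormal_basis V (J : eqType) (e : J -> V) :=
  (forall j k, inner (e j) (e k) = (j == k)%:R) /\ closed_span (range e) = setT.

(* y is the orthogonal projection of x onto A: y lies in A and x - y is
   orthogonal to A. *)
Definition is_projection V (A : set V) (x y : V) :=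
  A y /\ forall a, A a -> inner (x - y) a = 0.

Definition orthogonal_projection V (A : set V) (P : V -> V) :=
  forall x, is_projection A x (P x).

(* By the projection theorem the predicate below has exactly one solution when
   A is a closed subspace; the default value 0 plays no role then. *)
Definition proj V (A : set V) (x : V) : V := xget 0 (is_projection A x).

(* L is a linear isometry from E onto W. It is a total function whose values
   outside E are irrelevant. Without surjectivity the range of L would say
   nothing about the size of W. *)
Definition isometry_onto V V' (E : set V) (W : set V') (L : V -> V') :=
  [/\ forall (a : F) x y, E x -> E y -> L (a *: x + y) = a *: L x + L y,
      forall x, E x -> `|L x| = `|x| &
      L @` E = W].

(* The operator that agrees with L on the closed subspace E and vanishes on the
   orthogonal complement of E. *)
Definition extend0 V V' (E : set V) (L : V -> V') : V -> V' := L \o proj E.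

(* The bounds and weights are scalars; 0 < a forces a to be real when the
   scalars are complex. *)
Definition fusion_frame_with_bounds V (A B : F) (I : choiceType)
    (W : I -> set V) (v : I -> F) :=
  [/\ 0 < A <= B, forall i, closed_subspace (W i), forall i, 0 < v i &
      forall f : V, exists2 S : F,
        has_sum (fun i => v i ^+ 2 * `|proj (W i) f| ^+ 2 : F^o) S &
        A * `|f| ^+ 2 <= S <= B * `|f| ^+ 2].

Definition parseval_fusion_frame V (I : choiceType)
    (W : I -> set V) (v : I -> F) :=
  fusion_frame_with_bounds 1 1 W v.

End Subspaces.

(* Main.v *)
Require Import Defs.
From HB Require Import structures.
From mathcomp Require Import all_boot all_order all_algebra finmap.
From mathcomp Require Import sesquilinear.
From mathcomp Require Import boolp classical_sets functions reals topology normedtype.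
From mathcomp.analysis.showcase Require Import summability.
From mathcomp.real_closed Require Import complex.
From mathcomp Require Import ring lra.

(* A Parseval fusion frame is the same as an isometry f |-> (v_i P_i f)_i of H
   into the Hilbert direct sum K of the subspaces W_i. Its adjoint is the
   synthesis map (x_i)_i |-> sum_i v_i x_i, and an isometry composed with its
   adjoint is the orthogonal projection onto its range; the component of index i
   of K plays the role of E_i, and orthonormal bases of the components together
   form a basis of K.
   Conversely, P is self-adjoint and equals v_i L_i on E_i, so that for f in H
   the component of f in E_i is v_i L_i^-1 (P_i f), of norm v_i |P_i f|; by
   orthogonality of the E_i the squares of these norms add up to |f|^2.
   Convergent orthogonal sums also give the projection theorem: a maximal
   orthonormal subset of a closed subspace spans it, and the Fourier sum of x is
   the projection of x. *)

Set Implicit Arguments.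
Unset Strict Implicit.
Unset Printing Implicit Defensive.

Import Order.TTheory GRing.Theory Num.Theory.
Import numFieldNormedType.Exports.

Local Open Scope classical_set_scope.
Local Open Scope ring_scope.

(* This instance of the library is local to its section. *)
#[local] Existing Instance totally_filter.

(** * Splitting sums over finite index sets *)

Lemma fset_sumU (V : nmodType) (I : choiceType) (x : I -> V) (A B : {fset I}) :
  [disjoint A & B]%fset ->
  \sum_(i <- (A `|` B)%fset) x i = \sum_(i <- A) x i + \sum_(i <- B) x i.
Proof.
move=> AB; rewrite (perm_big (enum_fset A ++ enum_fset B)) /= ?big_cat//.
apply: uniq_perm; rewrite ?fset_uniq// ?cat_uniq ?fset_uniq /= ?andbT.
  apply/hasPn => x' xB; apply: contraTN AB => xA; rewrite -fsetI_eq0.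
  by apply/fset0Pn; exists x'; rewrite inE xA.
by move=> x'; rewrite mem_cat inE.
Qed.

Lemma fset_sumD (V : nmodType) (I : choiceType) (x : I -> V) (A B : {fset I}) :
  (A `<=` B)%fset ->
  \sum_(i <- B) x i = \sum_(i <- A) x i + \sum_(i <- (B `\` A)%fset) x i.
Proof.
move=> AB; rewrite -fset_sumU ?fsetUDl ?fsetDv ?fsetD0 ?(fsetUidPr _ _ AB)//.
by rewrite -fsetI_eq0; apply/eqP/fsetP => i; rewrite !inE; case: (i \in A).
Qed.

(** * Real and complex scalars treated uniformly *)

Section Scalars.
Variables (R : realType) (s : scalar_kind).
Local Notation F := (scalar_field R s).
Local Notation conj := (scalar_conj R s).

Lemma scalar_conjK : involutive conj.
Proof. by case: s => //= x; exact: conjcK. Qed.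

Lemma mul_scalar_conj (x : F) : x * conj x = `|x| ^+ 2.
Proof.
case: s x => /= x; last by rewrite sqr_normc.
by rewrite real_normK ?num_real ?expr2.
Qed.

Lemma norm_scalar_conj (x : F) : `|conj x| = `|x|.
Proof. by case: s x => //= x; rewrite normcJ. Qed.

Lemma scalar_conj_real (x : F) : conj x = x -> x \is Num.real.
Proof.
case: s x => /= x; first by rewrite num_real.
case: x => a b [] /eqP; rewrite complex_real.
by rewrite eqNr.
Qed.

Lemma scalar_real_conj (x : F) : x \is Num.real -> conj x = x.
Proof.
case: s x => //= -[a b]; rewrite complex_real => /eqP -> /=.
by rewrite oppr0.
Qed.

Lemma scalar_ge0_conj (x : F) : 0 <= x -> conj x = x.
Proof. by move/ger0_real/scalar_real_conj. Qed.

(** Being fixed by the conjugation, [x + conj x] is real and hence at most its own norm; the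
    triangle inequality does the rest. *)
Lemma scalar_add_conj_le (x : F) : x + conj x <= `|x| *+ 2.
Proof.
have re : x + conj x \is Num.real.
  by apply: scalar_conj_real; rewrite rmorphD /= scalar_conjK addrC.
apply: le_trans (real_ler_norm re) _; apply: le_trans (ler_normD _ _) _.
by rewrite norm_scalar_conj mulr2n.
Qed.

Lemma scalar_sqrt (x : F) : 0 <= x -> exists2 y : F, 0 <= y & y ^+ 2 = x.
Proof.
case: s x => /= x x0.
  by exists (Num.sqrt x); rewrite ?sqrtr_ge0 ?sqr_sqrtr.
by exists (sqrtC x); rewrite ?sqrtC_ge0 ?sqrtCK.
Qed.

(** The order on complex scalars is only partial, so suprema are taken in [R], through the real
    part. *)
Definition scalar_re : F -> R :=
  match s return scalar_field R s -> R with
  | RealScalars => id | ComplexScalars => @complex.Re R end.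

Lemma scalar_reD (x y : F) : scalar_re (x + y) = scalar_re x + scalar_re y.
Proof. by rewrite /scalar_re; case: s x y => //= [[? ?] [? ?]]. Qed.

Lemma le_scalar_re (x y : F) : x <= y -> scalar_re x <= scalar_re y.
Proof.
rewrite /scalar_re; case: s x y => //= [[? ?] [? ?]].
by rewrite lecE => /andP[].
Qed.

Lemma lt_scalar_re (x y : F) : 0 <= x -> 0 <= y ->
  (scalar_re x < scalar_re y) = (x < y).
Proof.
rewrite /scalar_re; case: s x y => //= [[a b] [c d]].
by rewrite !lecE ltcE /= => /andP[/eqP -> _] /andP[/eqP -> _]; rewrite eqxx.
Qed.

(* An order relation passes to the limit although the scalars may not be
   totally ordered: a limit of reals is fixed by the conjugation. *)
Lemma closed_le_scalar (l c : F) :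
  (forall e : F, 0 < e -> exists2 x, x <= c & `|l - x| < e) -> l <= c.
Proof.
move=> lc; pose d := l - c.
have dre : d \is Num.real.
  apply: scalar_conj_real; apply/eqP; rewrite eq_sym -subr_eq0 -normr_le0.
  rewrite real_leNgt ?normr_real ?real0 //.
  apply/negP => d0; have [|x xc lx] := lc (`|d - conj d| / 2).
    by rewrite divr_gt0.
  have tre : x - c \is Num.real by rewrite ler0_real// subr_le0.
  (* Subtracting the real number [x - c] from [d] does not change [d - conj d], which is therefore
     at most twice [|l - x|] in norm, and so strictly smaller than itself. *)
  have : `|d - conj d| < `|d - conj d|.
    have {1}-> : d - conj d = (l - x) - conj (l - x).
      have -> : l - x = d - (x - c) by rewrite /d; ring.
      by rewrite (rmorphB conj d) (scalar_real_conj tre); ring.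
    apply: le_lt_trans (ler_normB _ _) _.
    by rewrite norm_scalar_conj [ltRHS]splitr ltrD.
  by rewrite ltxx.
rewrite -subr_le0 real_leNgt ?real0 ?dre //; apply/negP => d0.
have [x xc] := lc d d0.
have t0 : 0 <= c - x by rewrite subr_ge0.
have -> : l - x = d + (c - x) by rewrite /d; ring.
rewrite ger0_norm; last exact: (addr_ge0 (ltW d0) t0).
by rewrite gtrDl => /(le_lt_trans t0); rewrite ltxx.
Qed.

(** Take [A] whose sum comes within [e] of the supremum of all finite sums: a disjoint [B] adds its
    sum to that of [A], and the total still cannot exceed the supremum. *)
Lemma fset_sum_tail (I : choiceType) (g : I -> F) (C : F) :
  (forall i, 0 <= g i) -> (forall A : {fset I}, \sum_(i <- A) g i <= C) ->
  forall e, 0 < e -> exists A : {fset I}, forall B : {fset I},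
    [disjoint A & B]%fset -> \sum_(i <- B) g i < e.
Proof.
move=> g0 gC e e0.
have sg0 (A : {fset I}) : 0 <= \sum_(i <- A) g i by apply: sumr_ge0.
pose S := [set x | exists A : {fset I}, x = scalar_re (\sum_(i <- A) g i)].
have Sub : ubound S (scalar_re C) by move=> _ [A ->]; apply: le_scalar_re.
have supS : has_sup S.
  by split; [exists (scalar_re (\sum_(i <- fset0) g i)), fset0|exists (scalar_re C)].
have re0 : 0 < scalar_re e.
  have z : scalar_re 0 = 0.
    by apply: (@addrI _ (scalar_re 0)); rewrite -scalar_reD !addr0.
  by rewrite -z lt_scalar_re// ltW.
have [_ [A ->] SA] := sup_adherent re0 supS.
exists A => B AB; rewrite -lt_scalar_re ?(ltW e0)//.
have : scalar_re (\sum_(i <- (A `|` B)%fset) g i) <= sup S.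
  by apply: ub_le_sup; [exists (scalar_re C)|exists (A `|` B)%fset].
rewrite fset_sumU// scalar_reD; lra.
Qed.

End Scalars.

(** * Unconditional sums *)

Section HasSum.
Variables (F : numFieldType) (I : choiceType).
Implicit Types V : normedModType F.

Lemma partial_sumE (V : zmodType) (x : I -> V) (A : {fset I}) :
  partial_sum x A = \sum_(i <- A) x i.
Proof. by rewrite /partial_sum big_seq_fsetE. Qed.

Lemma has_sumP V (x : I -> V) (l : V) : has_sum x l <->
  forall e, 0 < e -> exists A : {fset I}, forall B : {fset I},
    (A `<=` B)%fset -> `|l - \sum_(i <- B) x i| < e.
Proof.
split=> [xl e e0|xl].
  have /cvgrPdist_lt/(_ e e0) [A _ AB] := xl.
  by exists A => B /AB /=; rewrite partial_sumE.
apply/cvgrPdist_lt => e /xl [A AB]; exists A => // B /AB /=.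
by rewrite partial_sumE.
Qed.

Lemma has_sum_unique V (x : I -> V) (l m : V) :
  has_sum x l -> has_sum x m -> l = m.
Proof. exact: cvg_unique. Qed.

Lemma has_sum_lin V (x y : I -> V) (l m : V) (a : F) :
  has_sum x l -> has_sum y m -> has_sum (fun i => a *: x i + y i) (a *: l + m).
Proof.
move=> xl ym; rewrite /has_sum.
have -> : partial_sum (fun i => a *: x i + y i) =
    (fun A => a *: partial_sum x A + partial_sum y A).
  apply/funext => A; rewrite !partial_sumE scaler_sumr -big_split.
  by [].
by apply: cvgD ym; apply: cvgZr.
Qed.

(** Only additivity and a bound are asked of [f], so that the result also covers the conjugation of
    scalars, which is not linear in the complex case. *)
Lemma has_sum_map V (V' : normedModType F) (f : V -> V') (C : F)
    (x : I -> V) (l : V) :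
  zmod_morphism f -> 0 <= C -> (forall y, `|f y| <= C * `|y|) ->
  has_sum x l -> has_sum (f \o x) (f l).
Proof.
move=> fB C0 fC /has_sumP xl; apply/has_sumP => e e0.
have f0 : f 0 = 0 by rewrite -[in LHS](subr0 0) fB subrr.
have fD y z : f (y + z) = f y + f z.
  by rewrite -[in LHS](opprK z) fB -[- z]add0r fB f0 sub0r opprK.
(* [C] may be zero; [C + 1] is a safe divisor. *)
have D0 : 0 < C + 1 by rewrite ltr_wpDl.
have [|A AB] := xl (e / (C + 1)); first by rewrite divr_gt0.
exists A => B /AB; rewrite ltr_pdivlMr// => lB.
rewrite (_ : \sum_(i <- B) _ = f (\sum_(i <- B) x i)); last first.
  by elim/big_rec2: _ => [|i y1 y2 _ ->]; rewrite ?f0 ?fD.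
rewrite -fB; apply: le_lt_trans lB; apply: le_trans (fC _) _.
by rewrite mulrC ler_wpM2l// lerDl.
Qed.

Lemma has_sum_ext V (x y : I -> V) (l : V) :
  x =1 y -> has_sum x l -> has_sum y l.
Proof. by move/funext ->. Qed.

Lemma has_sum_finite V (x : I -> V) (A : {fset I}) :
  (forall i, i \notin A -> x i = 0) -> has_sum x (\sum_(i <- A) x i).
Proof.
move=> xA; apply/has_sumP => e e0; exists A => B /fsubsetP AB.
rewrite (_ : \sum_(i <- B) x i = \sum_(i <- A) x i) ?subrr ?normr0//.
rewrite [LHS](bigID (fun i => i \in A)) /= [X in _ + X]big1 ?addr0; last first.
  by move=> i; exact: xA.
rewrite -big_filter; apply: perm_big; apply: uniq_perm.
- by rewrite filter_uniq ?fset_uniq.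
- exact: fset_uniq.
- by move=> i; rewrite mem_filter andb_idr// => /AB.
Qed.

End HasSum.

(** * Dot forms and the Cauchy-Schwarz inequality *)

Section DotForm.
Variables (R : realType) (s : scalar_kind).
Local Notation F := (scalar_field R s).
Local Notation conj := (scalar_conj R s).
Variables (U : lmodType F) (f : {dot U for conj}).

Lemma dot_conj x y : f y x = conj (f x y).
Proof. by have := hermC f y x; rewrite expr0 mul1r. Qed.

Lemma dotZl a x y : f (a *: x) y = a * f x y.
Proof. exact: linearZl_LR. Qed.

Lemma dotZr a x y : f x (a *: y) = conj a * f x y.
Proof. exact: linearZr_LR. Qed.

Lemma dotDl x y z : f (x + y) z = f x z + f y z.
Proof. exact: linearDl. Qed.

Lemma dotDr x y z : f x (y + z) = f x y + f x z.
Proof. exact: linearDr. Qed.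

Lemma dotBl x y z : f (x - y) z = f x z - f y z.
Proof. exact: linearBl. Qed.

Lemma dotBr x y z : f x (y - z) = f x y - f x z.
Proof. exact: linearBr. Qed.

Lemma dot0l x : f 0 x = 0.
Proof. exact: linear0l. Qed.

Lemma dot0r x : f x 0 = 0.
Proof. exact: linear0r. Qed.

Lemma dot_suml (I : Type) (r : seq I) (u : I -> U) x :
  f (\sum_(i <- r) u i) x = \sum_(i <- r) f (u i) x.
Proof. exact: linear_sumlz. Qed.

Lemma dot_sumr (I : Type) (r : seq I) (u : I -> U) x :
  f x (\sum_(i <- r) u i) = \sum_(i <- r) f x (u i).
Proof. exact: linear_sumr. Qed.

Lemma dot_ge0 x : 0 <= f x x.
Proof.
have [->|x0] := eqVneq x 0; first by rewrite dot0l.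
by apply: ltW; exact: (@neq0_dnorm_gt0 _ _ _ f).
Qed.

(** Expand the nonnegative value of the form at [f y y *: x - f x y *: y] and divide by [f y y]. The
    statement is about a bare form because the norm of the Hilbert direct sum is itself built from
    its form by this inequality. *)
Lemma dot_cauchy_schwarz x y : `|f x y| ^+ 2 <= f x x * f y y.
Proof.
have [->|y0] := eqVneq y 0; first by rewrite !dot0r normr0 mulr0 expr0n.
have fy0 : 0 < f y y by exact: (@neq0_dnorm_gt0 _ _ _ f).
have := dot_ge0 (f y y *: x - f x y *: y).
rewrite dotBl !dotBr !dotZl !dotZr (scalar_ge0_conj (ltW fy0)).
rewrite -(dot_conj x y) -mul_scalar_conj -(dot_conj x y).
set a := f y y; set b := f x y; set c := f y x; set d := f x x.
have -> : a * (a * d) - a * (c * b) - (b * (a * c) - b * (c * a)) =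
  a * (d * a - b * c) by ring.
by rewrite pmulr_rge0// subr_ge0.
Qed.

End DotForm.

(** * Norm identities and convergence criteria in a Hilbert space *)

Section Inner.
Variables (R : realType) (s : scalar_kind).
Local Notation F := (scalar_field R s).
Local Notation conj := (scalar_conj R s).
Variable V : hilbertType conj.
Implicit Types (x y z : V) (A M : set V).

Lemma cauchy_schwarz x y : `|inner x y| <= `|x| * `|y|.
Proof.
rewrite -(@ler_pXn2r _ 2) ?nnegrE ?mulr_ge0// exprMn -!inner_norm.
exact: dot_cauchy_schwarz.
Qed.

Lemma normsqD x y :
  `|x + y| ^+ 2 = `|x| ^+ 2 + `|y| ^+ 2 + (inner x y + conj (inner x y)).
Proof.
by rewrite -!inner_norm dotDl !dotDr (dot_conj inner x y) /=; ring.
Qed.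

(** The parallelogram law, with the square of [|x - y|] dropped. *)
Lemma normsqD_le x y : `|x + y| ^+ 2 <= 2 * `|x| ^+ 2 + 2 * `|y| ^+ 2.
Proof.
have -> : 2 * `|x| ^+ 2 + 2 * `|y| ^+ 2 = `|x + y| ^+ 2 + `|x - y| ^+ 2.
  rewrite !normsqD normrN; rewrite (_ : inner x (- y) = - inner x y); last first.
    by rewrite -sub0r dotBr dot0r sub0r.
  by rewrite rmorphN /=; ring.
by rewrite lerDl exprn_ge0.
Qed.

Lemma pythagoras x y : inner x y = 0 ->
  `|x + y| ^+ 2 = `|x| ^+ 2 + `|y| ^+ 2.
Proof. by move=> xy; rewrite normsqD xy rmorph0 !addr0. Qed.

Lemma inner_sym0 x y : inner x y = 0 -> inner y x = 0.
Proof. by rewrite (dot_conj inner x y) => ->; rewrite rmorph0. Qed.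

Lemma inner_eq0 x : inner x x = 0 -> x = 0.
Proof. by rewrite inner_norm => /eqP; rewrite sqrf_eq0 normr_eq0 => /eqP. Qed.

Lemma normsq_orth_sum (I : eqType) (u : I -> V) (r : seq I) : uniq r ->
  (forall i j, i != j -> inner (u i) (u j) = 0) ->
  `|\sum_(i <- r) u i| ^+ 2 = \sum_(i <- r) `|u i| ^+ 2.
Proof.
move=> + uo; elim: r => [|i r IH] /=; first by rewrite !big_nil normr0 expr0n.
move=> /andP[ir ur]; rewrite !big_cons pythagoras ?IH//.
rewrite dot_sumr big_seq big1// => j jr; apply: uo.
by apply: contraNneq ir => ->.
Qed.

Lemma has_sum_inner (I : choiceType) (x : I -> V) l z : has_sum x l ->
  has_sum (fun i => inner (x i) z : F^o) (inner l z).
Proof.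
apply: (@has_sum_map _ _ V F^o (fun y => inner y z) `|z|) => //.
  by move=> y y'; rewrite dotBl.
by move=> y; rewrite mulrC cauchy_schwarz.
Qed.

(** Blocks of indices far out have a small [g]-sum by [fset_sum_tail], hence a small norm, and
    completeness of [V] gives the limit. Finite sums are bounded as a whole rather than term by
    term, since orthogonal series need not converge absolutely. *)
Lemma has_sum_dominated (I : choiceType) (x : I -> V) (g : I -> F) (C D : F) :
  (forall i, 0 <= g i) -> (forall A : {fset I}, \sum_(i <- A) g i <= C) ->
  0 <= D ->
  (forall A : {fset I}, `|\sum_(i <- A) x i| ^+ 2 <= D * \sum_(i <- A) g i) ->
  exists l, has_sum x l.
Proof.
move=> g0 gC D0 xg.
have cv : cvg (partial_sum x @ totally).
  apply: cauchy_cvg; apply: cauchy_exP => e e0.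
  have D1 : 0 < D + 1 by rewrite ltr_wpDl.
  have [|A0 tail] := fset_sum_tail g0 gC (e := e ^+ 2 / (D + 1)).
    by rewrite divr_gt0 ?exprn_gt0.
  exists (partial_sum x A0); exists A0 => // B /= A0B.
  rewrite -ball_normE /ball_ /= !partial_sumE.
  rewrite (fset_sumD _ A0B) opprD addNKr normrN.
  rewrite -(@ltr_pXn2r _ 2) ?nnegrE ?(ltW e0) ?normr_ge0//.
  have dis : [disjoint A0 & B `\` A0]%fset.
    by rewrite -fsetI_eq0; apply/eqP/fsetP => i; rewrite !inE; case: (i \in A0).
  have := tail _ dis; rewrite ltr_pdivlMr// => tB.
  apply: le_lt_trans (xg _) _; apply: le_lt_trans tB.
  by rewrite mulrC ler_wpM2l ?sumr_ge0// lerDl.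
by exists (lim (partial_sum x @ totally)).
Qed.

Lemma sum_le_has_sum (I : choiceType) (g : I -> F) l (A : {fset I}) :
  (forall i, 0 <= g i) -> has_sum (g : I -> F^o) l -> \sum_(i <- A) g i <= l.
Proof.
move=> g0 /has_sumP gl; rewrite -lerN2; apply: closed_le_scalar => e /gl[B lB].
(* Signs are reversed because [closed_le_scalar] gives upper bounds on limits. Joining [A] to [B]
   keeps the sum close to [l] and makes it dominate the sum over [A]. *)
exists (- \sum_(i <- (A `|` B)%fset) g i).
  by rewrite lerN2 (fset_sumD _ (fsubsetUl A B)) lerDl sumr_ge0.
by rewrite -opprD normrN; apply: lB; exact: fsubsetUr.
Qed.

Lemma has_sum_le (I : choiceType) (g : I -> F) l c :
  has_sum (g : I -> F^o) l ->
  (forall A : {fset I}, \sum_(i <- A) g i <= c) -> l <= c.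
Proof.
move=> /has_sumP gl gc; apply: closed_le_scalar => e /gl[B lB].
by exists (\sum_(i <- B) g i) => //; exact: lB.
Qed.

End Inner.
Arguments has_sum_inner {R s V I x l} z _.

(** * Closed subspaces and the projection theorem *)

Section Subspaces.
Variables (R : realType) (s : scalar_kind).
Local Notation F := (scalar_field R s).
Local Notation conj := (scalar_conj R s).
Variable V : hilbertType conj.
Implicit Types (x y z : V) (A M : set V).

Lemma closureP A x :
  closure A x <-> forall e : F, 0 < e -> exists2 a, A a & `|x - a| < e.
Proof.
split=> [Ax e e0|Ax B /nbhs_ballP[e e0 eB]].
  have [a [Aa]] := Ax _ (nbhsx_ballx x e e0).
  by rewrite -ball_normE; exists a.
have [a Aa xa] := Ax e e0; exists a; split=> //; apply: eB.
by rewrite -ball_normE.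
Qed.

Lemma submodP M : submod_closed (mem M) <->
  M 0 /\ forall (a : F) x y, M x -> M y -> M (a *: x + y).
Proof.
split=> -[M0 Ml]; split.
- by have := M0; rewrite inE.
- by move=> a x y Mx My; have := Ml a x y; rewrite !inE; exact.
- by rewrite inE.
- by move=> a x y; rewrite !inE; exact: Ml.
Qed.

Lemma closed_linear_subspaceP M : closed_subspace M <->
  [/\ M 0, forall (a : F) x y, M x -> M y -> M (a *: x + y) &
   forall x, (forall e : F, 0 < e -> exists2 a, M a & `|x - a| < e) -> M x].
Proof.
split=> [[/submodP[M0 Ml] Mc]|[M0 Ml Mc]].
  by split=> // x /closureP; exact: Mc.
by split=> [|x /closureP]; [exact/submodP|exact: Mc].
Qed.

Lemma closed_subspace0 M : closed_subspace M -> M 0.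
Proof. by move=> /closed_linear_subspaceP[]. Qed.

Lemma closed_subspaceD M x y : closed_subspace M -> M x -> M y -> M (x + y).
Proof.
by move=> /closed_linear_subspaceP[_ Ml _] Mx My; rewrite -[x]scale1r; exact: Ml.
Qed.

Lemma closed_subspaceB M x y : closed_subspace M -> M x -> M y -> M (x - y).
Proof.
by move=> /closed_linear_subspaceP[_ Ml _] Mx My; rewrite addrC -scaleN1r; exact: Ml.
Qed.

Lemma closed_subspaceZ M (a : F) x : closed_subspace M -> M x -> M (a *: x).
Proof.
by move=> /closed_linear_subspaceP[M0 Ml _] Mx; rewrite -[_ *: _]addr0; exact: Ml.
Qed.

Lemma closed_subspace_has_sum (I : choiceType) M (x : I -> V) l :
  closed_subspace M -> (forall i, M (x i)) -> has_sum x l -> M l.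
Proof.
move=> Mc Mx /has_sumP xl; have /closed_linear_subspaceP[M0 _] := Mc.
apply => e /xl[B lB].
exists (\sum_(i <- B) x i); last exact: lB.
by apply: big_ind => //; move=> ? ?; exact: closed_subspaceD.
Qed.

Lemma closed_span_closed A : closed_subspace (closed_span A).
Proof.
pose S := smallest (fun M : set V => submod_closed (mem M)) A.
have [S0 Sl] : S 0 /\ forall (a : F) x y, S x -> S y -> S (a *: x + y).
  split=> [N [/submodP[]]//|a x y Sx Sy N NA].
  have [/submodP[_ Nl] _] := NA; exact: Nl (Sx _ NA) (Sy _ NA).
apply/closed_linear_subspaceP; split.
- exact: subset_closure.
- move=> a x y /closureP Sx /closureP Sy; apply/closureP => e e0.
  have D0 : 0 < `|a| + 1 by rewrite ltr_wpDl.
  have [|x' Sx' xx'] := Sx (e / 2 / (`|a| + 1)); first by rewrite !divr_gt0.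
  have [|y' Sy' yy'] := Sy (e / 2); first by rewrite divr_gt0.
  exists (a *: x' + y'); first exact: Sl.
  rewrite opprD addrACA -scalerBr (splitr e); apply: le_lt_trans (ler_normD _ _) _.
  rewrite normrZ ltr_leD ?(ltW yy')//; move: xx'; rewrite ltr_pdivlMr//.
  by apply: le_lt_trans; rewrite mulrC ler_wpM2l// lerDl.
- by move=> x Sx; apply: (@closed_closure _ S); apply/closureP.
Qed.

Lemma sub_closed_span A : A `<=` closed_span A.
Proof. by move=> x Ax; apply: subset_closure => N [_]; exact. Qed.

Lemma closed_span_min A M : closed_subspace M -> A `<=` M -> closed_span A `<=` M.
Proof.
move=> [Ml Mc] AM; rewrite [X in _ `<=` X]((closure_id M).1 Mc).
by apply: closureS; apply: smallest_sub.
Qed.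

(** Cauchy-Schwarz makes the inner product with [z] continuous, so its kernel is closed. *)
Lemma orthogonal_closed_subspace z : closed_subspace [set x | inner x z = 0].
Proof.
apply/closed_linear_subspaceP; split=> /=; first by rewrite dot0l.
  by move=> a x y xz yz; rewrite dotDl dotZl xz yz mulr0 addr0.
move=> x xz; apply/eqP; rewrite -normr_le0; apply: closed_le_scalar => e e0.
have D0 : 0 < `|z| + 1 by rewrite ltr_wpDl.
have [|a az xa] := xz (e / (`|z| + 1)); first by rewrite divr_gt0.
exists 0 => //; rewrite subr0 normr_id -[inner x z]subr0 -az -dotBl.
apply: le_lt_trans (cauchy_schwarz _ _) _; move: xa; rewrite ltr_pdivlMr//.
by apply: le_lt_trans; rewrite ler_wpM2l// lerDl.
Qed.

Lemma orthogonal_closed_span A z : (forall a, A a -> inner a z = 0) ->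
  forall x, closed_span A x -> inner x z = 0.
Proof. by move=> Az; apply: closed_span_min => //; exact: orthogonal_closed_subspace. Qed.

Lemma is_projection_unique A x y z : closed_subspace A ->
  is_projection A x y -> is_projection A x z -> y = z.
Proof.
move=> Ac [Ay xy] [Az xz]; apply/eqP; rewrite -subr_eq0; apply/eqP/inner_eq0.
have Ayz : A (y - z) by exact: closed_subspaceB.
have {1}-> : y - z = (x - z) - (x - y) by rewrite opprB [RHS]addrC subrKA.
by rewrite dotBl xy// xz// subrr.
Qed.

Lemma projE A x y : closed_subspace A -> is_projection A x y -> proj A x = y.
Proof.
move=> Ac xy; apply: (is_projection_unique Ac _ xy).
by apply: (@xgetPex _ 0 (is_projection A x)); exists y.
Qed.

(* Bessel's inequality bounds the partial sums of the squared norms, which makes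
   u summable. *)
Lemma orthogonal_components (I : choiceType) (u : I -> V) x :
  (forall i j, i != j -> inner (u i) (u j) = 0) ->
  (forall i, inner x (u i) = `|u i| ^+ 2) ->
  exists2 y, has_sum u y &
    forall i z, (forall j, j != i -> inner (u j) z = 0) -> inner y z = inner (u i) z.
Proof.
move=> uo xu.
have nu (A : {fset I}) : `|\sum_(i <- A) u i| ^+ 2 = \sum_(i <- A) `|u i| ^+ 2.
  by apply: normsq_orth_sum => //; exact: fset_uniq.
have [|A|||y uy] := @has_sum_dominated _ _ _ _ u (fun i => `|u i| ^+ 2) (`|x| ^+ 2) 1.
- by move=> i; rewrite exprn_ge0.
- rewrite -nu; set S := \sum_(i <- A) _.
  have -> : x = (x - S) + S by rewrite subrK.
  rewrite pythagoras ?lerDr ?exprn_ge0// dotBl [X in _ - X]inner_norm nu.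
  by rewrite dot_sumr (eq_bigr _ (fun i _ => xu i)) subrr.
- by [].
- by move=> A; rewrite mul1r nu.
exists y => // i z uz.
apply: (@has_sum_unique _ _ F^o _ _ _ (has_sum_inner z uy)).
have -> : inner (u i) z = \sum_(j <- [fset i]%fset) inner (u j) z.
  by rewrite big_seq_fset1.
by apply: (@has_sum_finite _ _ F^o) => j; rewrite inE => /uz.
Qed.

Definition orthonormal_set A :=
  forall b c, A b -> A c -> inner b c = (b == c)%:R.

(** The projection is the Fourier sum of [x], which converges by [orthogonal_components]. Its inner
    product with each member of [A] agrees with that of [x], and orthogonality of the residual
    extends to the closed span. *)
Lemma projection_onto_span A x : orthonormal_set A ->
  exists y, is_projection (closed_span A) x y.
Proof.
(* The family is indexed by all of [V] and vanishes off [A], so that the vectors of [A] serve as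
   their own indices. *)
move=> oA; pose u b := if `[< A b >] then inner x b *: b else 0.
have uA b : A b -> u b = inner x b *: b by move=> Ab; rewrite /u asboolT.
have uNA b : ~ A b -> u b = 0 by move=> Ab; rewrite /u asboolF.
have uo c b : A b -> c != b -> inner (u c) b = 0.
  move=> Ab cb; have [Ac|/uNA->] := pselect (A c); last by rewrite dot0l.
  by rewrite uA// dotZl (oA c b)// (negPf cb) mulr0.
have [|b|y uy yu] := @orthogonal_components _ u x.
- move=> b c bc; have [Ac|/uNA->] := pselect (A c); last by rewrite dot0r.
  by rewrite (uA c Ac) dotZr uo// mulr0.
- have [Ab|/uNA->] := pselect (A b); last by rewrite dot0r normr0 expr0n.
  rewrite uA// dotZr normrZ exprMn -mul_scalar_conj -(inner_norm b) (oA b b)// eqxx.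
  by rewrite mulr1 mulrC.
exists y; split.
  apply: closed_subspace_has_sum (closed_span_closed A) _ uy => b.
  have [Ab|/uNA->] := pselect (A b); last first.
    exact: closed_subspace0 (closed_span_closed A).
  rewrite uA//; apply: (closed_subspaceZ _ (closed_span_closed A)).
  exact: sub_closed_span.
move=> a Aa; apply: inner_sym0; apply: (orthogonal_closed_span (A := A)) Aa => b Ab.
apply: inner_sym0; rewrite dotBl (yu b) ?uA ?dotZl ?(oA b b) ?eqxx ?mulr1 ?subrr//.
by move=> c; exact: uo.
Qed.

(** Zorn's lemma gives a maximal orthonormal subset of [M]; a vector of [M] outside its closed span
    would leave a nonzero residual that enlarges it. *)
Lemma orthonormal_spanning_set M : closed_subspace M ->
  exists2 A, orthonormal_set A & closed_span A = M.
Proof.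
move=> Mc; have [|A [[AM oA] Amax]] :=
    @Zorn_bigcup V (fun A => A `<=` M /\ orthonormal_set A).
  move=> C CP Ctot; split; first by apply: bigcup_sub => X /CP[].
  move=> b c [X CX Xb] [Y CY Yc]; have [XY|YX] := Ctot X Y CX CY.
    by apply: (CP _ CY).2 => //; exact: XY.
  by apply: (CP _ CX).2 => //; exact: YX.
exists A => //; rewrite eqEsubset; split; first exact: closed_span_min.
move=> x Mx; have [y [Sy xy]] := projection_onto_span x oA.
have Myx : M (x - y) by apply: closed_subspaceB => //; exact: closed_span_min Sy.
have [/eqP|z0] := eqVneq (x - y) 0; first by rewrite subr_eq0 => /eqP ->.
(* The normalised residual [b] is a unit vector of [M] orthogonal to [A], so adjoining it
   contradicts maximality. *)
pose n := `|x - y|; pose b := n^-1 *: (x - y).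
have n0 : n != 0 by rewrite normr_eq0.
have nn : conj n^-1 = n^-1 by rewrite scalar_ge0_conj// invr_ge0 normr_ge0.
have bb : inner b b = 1.
  by rewrite dotZl dotZr inner_norm nn expr2 mulKf// mulVf.
have bA a : A a -> inner b a = 0.
  by move=> Aa; rewrite dotZl xy ?mulr0//; exact: sub_closed_span.
have Ab : ~ A b by move=> /bA; rewrite bb => /eqP; rewrite oner_eq0.
exfalso; apply: (Amax (A `|` [set b])).
  by split=> [|H]; [left|apply: Ab; apply: H; right].
split.
  by move=> c [/AM//|->]; apply: closed_subspaceZ.
move=> c d [Ac|->] [Ad|->].
- exact: oA.
- by rewrite (inner_sym0 (bA _ Ac)); case: eqP Ab => // <-.
- by rewrite bA//; case: eqP Ab => // ->.
- by rewrite bb eqxx.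
Qed.

Lemma projP M x : closed_subspace M -> is_projection M x (proj M x).
Proof.
move=> Mc; apply: (@xgetPex _ 0 (is_projection M x)).
by have [A oA <-] := orthonormal_spanning_set Mc; exact: projection_onto_span.
Qed.

(** The residual of any [x] after projection is orthogonal to [A], hence zero. *)
Lemma closed_span_full A :
  (forall x, (forall a, A a -> inner x a = 0) -> x = 0) -> closed_span A = setT.
Proof.
move=> A0; rewrite -subTset => x _.
have [Sy xy] := projP x (closed_span_closed A).
suff /eqP : x - proj (closed_span A) x = 0 by rewrite subr_eq0 => /eqP ->.
by apply: A0 => a Aa; apply: xy; exact: sub_closed_span.
Qed.

(** Parseval's identity for an orthogonal decomposition: the components of [x] have a sum [y], and
    [x - y] is orthogonal to every [E i], so [y] is [x]. The inner product with [x] turns this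
    series of vectors into the series of squared norms. *)
Lemma has_sum_normsq_proj (I : choiceType) (E : I -> set V) x :
  (forall i, closed_subspace (E i)) ->
  (forall i j, i != j -> forall y z, E i y -> E j z -> inner y z = 0) ->
  closed_span (\bigcup_i E i) = setT ->
  has_sum (fun i => `|proj (E i) x| ^+ 2 : F^o) (`|x| ^+ 2).
Proof.
move=> Ec Eo Efull; pose u i := proj (E i) x.
have Eu i : E i (u i) by have [] := projP x (Ec i).
have uE i z : E i z -> inner x z = inner (u i) z.
  move=> Ez; have [_ /(_ _ Ez)] := projP x (Ec i).
  by rewrite dotBl => /eqP; rewrite subr_eq0 => /eqP.
have uu i : inner x (u i) = `|u i| ^+ 2 by rewrite (uE i)// inner_norm.
have [||y uy yu] := @orthogonal_components _ u x => //.
  by move=> i j ij; exact: Eo ij _ _ _ _.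
have xy : x = y.
  apply/eqP; rewrite -subr_eq0; apply/eqP/inner_eq0.
  apply: (@orthogonal_closed_span (\bigcup_i E i)); last by rewrite Efull.
  move=> z [i _ Ez]; apply: inner_sym0; rewrite dotBl (yu i) ?(uE i)// ?subrr//.
  by move=> j ji; exact: Eo ji _ _ _ _.
rewrite -inner_norm {2}xy; apply: has_sum_ext (has_sum_inner x uy) => i.
by rewrite (dot_conj inner x) /= uu scalar_ge0_conj// exprn_ge0.
Qed.

End Subspaces.

(** * The Hilbert direct sum of closed subspaces *)

Section DirectSum.
Variables (R : realType) (s : scalar_kind).
Local Notation F := (scalar_field R s).
Local Notation conj := (scalar_conj R s).
Variables (H : hilbertType conj) (I : choiceType) (W : I -> set H).

(** A bound on the finite sums passes to linear combinations by [normsqD_le], with no limit to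
    handle. *)
Definition square_summable (x : I -> H) :=
  exists C : F, forall A : {fset I}, \sum_(i <- A) `|x i| ^+ 2 <= C.

(* The unused argument lets the canonical structures below, which depend on the
   W i being closed subspaces, be inferred from the predicate. *)
Definition l2_sum_pred of (forall i, closed_subspace (W i)) : {pred I -> H} :=
  [pred x | `[< (forall i, W i (x i)) /\ square_summable x >]].

Variable Wc : forall i, closed_subspace (W i).

Lemma l2_sum_submod_closed : submod_closed (l2_sum_pred Wc).
Proof.
split.
  apply/asboolP; split=> [i|]; first exact: closed_subspace0.
  by exists 0 => A; rewrite big1// => i _; rewrite normr0 expr0n.
move=> a x y /asboolP[Wx [C xC]] /asboolP[Wy [D yD]]; apply/asboolP; split.
  by move=> i; have /closed_linear_subspaceP[_ Wl _] := Wc i; exact: Wl.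
exists (2 * `|a| ^+ 2 * C + 2 * D) => A.
apply: le_trans (_ : \sum_(i <- A) (2 * `|a| ^+ 2 * `|x i| ^+ 2 + 2 * `|y i| ^+ 2) <= _).
  apply: ler_sum => i _; apply: le_trans (normsqD_le _ _) _.
  by rewrite normrZ exprMn mulrA.
rewrite big_split /= -!mulr_sumr lerD// ler_wpM2l// mulr_ge0// exprn_ge0//.
Qed.

HB.instance Definition _ :=
  GRing.isSubmodClosed.Build F (I -> H) (l2_sum_pred Wc) l2_sum_submod_closed.

Record l2_sum := L2Sum { l2_val :> I -> H; l2_valP : l2_val \in l2_sum_pred Wc }.

HB.instance Definition _ := [isSub for l2_val].
HB.instance Definition _ := [Choice of l2_sum by <:].
HB.instance Definition _ := [SubChoice_isSubLmodule of l2_sum by <:].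

Implicit Types x y z : l2_sum.

Lemma l2_sumP x : (forall i, W i (x i)) /\ square_summable x.
Proof. by apply/asboolP; exact: l2_valP. Qed.

Lemma l2_linE (a : F) x y i : (a *: x + y) i = a *: x i + y i.
Proof. by []. Qed.

Lemma l2_subE x y i : (x - y) i = x i - y i.
Proof. by []. Qed.

Lemma l2_sum_inj x y : (forall i, x i = y i) -> x = y.
Proof. by move=> xy; apply/val_inj/funext. Qed.

(* The scalars embed isometrically in a nonzero H, whose completeness gives the
   convergence of the series of scalars. *)
Lemma l2_inner_has_sum x y :
  exists l : F, has_sum (fun i => inner (x i) (y i) : F^o) l.
Proof.
have [_ [C xC]] := l2_sumP x; have [_ [D yD]] := l2_sumP y.
have [[h /eqP h0]|H0] := pselect (exists h : H, h <> 0); last first.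
  have xy0 i : inner (x i) (y i) = 0.
    have -> : x i = 0 by apply: contrapT => xi; apply: H0; exists (x i).
    exact: dot0l.
  exists (\sum_(i <- fset0) (inner (x i) (y i) : F^o)).
  by apply: has_sum_finite => i _; exact: xy0.
(* [g] dominates the inner products by Cauchy-Schwarz and the arithmetic-geometric mean inequality.
   One factor of the squared sum of [g] is then bounded by [C + D], which leaves the linear bound
   that [has_sum_dominated] needs. *)
pose g i := `|x i| ^+ 2 + `|y i| ^+ 2.
have g0 i : 0 <= g i by rewrite addr_ge0// exprn_ge0.
have gCD (A : {fset I}) : \sum_(i <- A) g i <= C + D by rewrite big_split lerD.
have CD0 : 0 <= C + D by apply: le_trans (gCD fset0); rewrite big_nil.
have xyg i : `|inner (x i) (y i)| <= g i.
  apply: le_trans (cauchy_schwarz _ _) _.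
  apply: le_trans (_ : _ <= (g i) / 2) _.
    by apply: (real_leif_mean_square _ _).1; rewrite normr_real.
  by rewrite ler_pdivrMr// ler_peMr// ler1n.
have [|A|l xl] := @has_sum_dominated _ _ H I (fun i => inner (x i) (y i) *: h)
    g (C + D) ((C + D) * `|h| ^+ 2) g0 gCD.
- by rewrite mulr_ge0// exprn_ge0.
- rewrite -scaler_suml normrZ exprMn [leRHS]mulrAC ler_wpM2r ?exprn_ge0//.
  apply: le_trans (_ : (\sum_(i <- A) g i) ^+ 2 <= _).
    rewrite ler_pXn2r ?nnegrE ?sumr_ge0//; apply: le_trans (ler_norm_sum _ _ _) _.
    exact: ler_sum.
  by rewrite expr2 ler_wpM2r ?sumr_ge0.
(* Pairing with [h] and dividing by its squared norm recovers the scalar series from the vector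
   series. *)
exists (inner l h / `|h| ^+ 2).
have hh0 : `|h| ^+ 2 != 0 by rewrite sqrf_eq0 normr_eq0.
pose f (z : F^o) : F^o := z / `|h| ^+ 2.
have fB : zmod_morphism f by move=> u v; rewrite /f mulrBl.
have C0 : 0 <= (`|h| ^+ 2)^-1 by rewrite invr_ge0 exprn_ge0.
have fC u : `|f u| <= (`|h| ^+ 2)^-1 * `|u|.
  by rewrite normrM normfV mulrC (ger0_norm (exprn_ge0 _ _)).
apply: has_sum_ext (has_sum_map fB C0 fC (has_sum_inner h xl)) => i.
by rewrite /f /= dotZl inner_norm mulfK.
Qed.

Definition l2_inner x y : F := sval (cid (l2_inner_has_sum x y)).

Lemma l2_innerP x y : has_sum (fun i => inner (x i) (y i) : F^o) (l2_inner x y).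
Proof. exact: svalP (cid _). Qed.
Arguments l2_innerP : clear implicits.

Lemma l2_innerE x y l :
  has_sum (fun i => inner (x i) (y i) : F^o) l -> l2_inner x y = l.
Proof. exact: (@has_sum_unique _ _ F^o _ _ _ (l2_innerP x y)). Qed.

Lemma l2_inner_conj x y : l2_inner y x = conj (l2_inner x y).
Proof.
apply: l2_innerE.
have fC (z : F) : `|conj z| <= 1 * `|z| by rewrite mul1r norm_scalar_conj.
have := @has_sum_map _ _ F^o F^o conj 1 _ _ (rmorphB conj) ler01 fC (l2_innerP x y).
apply: has_sum_ext => i.
by rewrite /= -(dot_conj inner).
Qed.

Lemma l2_innerPl (a : F) x y z :
  l2_inner (a *: x + y) z = a * l2_inner x z + l2_inner y z.
Proof.
apply: l2_innerE.
have := has_sum_lin (a := a) (l2_innerP x z) (l2_innerP y z).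
by apply: has_sum_ext => i; rewrite l2_linE dotDl dotZl.
Qed.

Lemma l2_inner_hermitian x y : l2_inner x y = (-1) ^+ false * conj (l2_inner y x).
Proof. by rewrite expr0 mul1r l2_inner_conj. Qed.

Lemma l2_inner_bilinear :
  bilinear_for (GRing.Scale.Law.clone _ _ *%R _)
    (GRing.Scale.Law.clone _ _ (conj \; *%R) _) l2_inner.
Proof.
split=> [z a x y|z a x y]; first exact: l2_innerPl.
by rewrite 3!(l2_inner_conj _ z) l2_innerPl rmorphD rmorphM.
Qed.
HB.instance Definition _ :=
  bilinear_isBilinear.Build F l2_sum l2_sum F _ _ l2_inner l2_inner_bilinear.
HB.instance Definition _ :=
  isHermitianSesquilinear.Build F l2_sum false conj l2_inner l2_inner_hermitian.

Lemma l2_normsq_le x (A : {fset I}) : \sum_(i <- A) `|x i| ^+ 2 <= l2_inner x x.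
Proof.
apply: (@sum_le_has_sum R s) => [i|]; first by rewrite exprn_ge0.
by apply: has_sum_ext (l2_innerP x x) => i; rewrite inner_norm.
Qed.

Lemma l2_inner_gt0 x : x != 0 -> 0 < l2_inner x x.
Proof.
move=> x0; have /existsNP[i xi] : ~ forall i, x i = 0.
  by move=> xi; case/eqP: x0; exact: l2_sum_inj.
apply: lt_le_trans (l2_normsq_le x [fset i]%fset).
by rewrite big_seq_fset1 exprn_gt0// normr_gt0; exact/eqP.
Qed.
HB.instance Definition _ := isDotProduct.Build F l2_sum l2_inner l2_inner_gt0.

Definition l2_dot : {dot l2_sum for conj} := l2_inner.

Definition l2_norm x : F := sval (cid2 (scalar_sqrt (dot_ge0 l2_dot x))).

Lemma l2_norm_ge0 x : 0 <= l2_norm x.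
Proof. by rewrite /l2_norm; case: cid2. Qed.

Lemma l2_norm_sqr x : l2_norm x ^+ 2 = l2_inner x x.
Proof. by rewrite /l2_norm; case: cid2. Qed.

(** After squaring, the cross term is an inner product plus its conjugate, at most twice its norm,
    to which Cauchy-Schwarz applies. *)
Lemma l2_normD x y : l2_norm (x + y) <= l2_norm x + l2_norm y.
Proof.
rewrite -(@ler_pXn2r _ 2) ?nnegrE ?addr_ge0 ?l2_norm_ge0// sqrrD !l2_norm_sqr.
have -> : l2_inner (x + y) (x + y) =
    l2_inner x x + (l2_inner x y + conj (l2_inner x y)) + l2_inner y y.
  rewrite (dotDl l2_dot) !(dotDr l2_dot) (dot_conj l2_dot x y) /=; ring.
rewrite lerD2r lerD2l; apply: le_trans (scalar_add_conj_le _) _.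
rewrite lerMn2r /= -(@ler_pXn2r _ 2) ?nnegrE ?mulr_ge0 ?l2_norm_ge0//.
by rewrite exprMn !l2_norm_sqr; exact: (dot_cauchy_schwarz l2_dot).
Qed.

Lemma l2_normZ (a : F) x : l2_norm (a *: x) = `|a| * l2_norm x.
Proof.
apply/eqP; rewrite -(@eqrXn2 _ 2) ?mulr_ge0 ?l2_norm_ge0//.
rewrite exprMn !l2_norm_sqr (dotZl l2_dot) (dotZr l2_dot) -mul_scalar_conj.
by rewrite mulrA.
Qed.

Lemma l2_norm_eq0 x : l2_norm x = 0 -> x = 0.
Proof.
move=> nx; apply/eqP; apply: contraT => /l2_inner_gt0.
by rewrite -l2_norm_sqr nx expr0n ltxx.
Qed.

HB.instance Definition _ :=
  Lmodule_isNormed.Build F l2_sum l2_normD l2_normZ l2_norm_eq0.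

Lemma l2_normsqE x : `|x| ^+ 2 = l2_inner x x.
Proof. exact: l2_norm_sqr. Qed.

Lemma l2_coord_le x i : `|x i| <= `|x|.
Proof.
rewrite -(@ler_pXn2r _ 2) ?nnegrE// l2_normsqE.
by apply: le_trans (l2_normsq_le x [fset i]%fset); rewrite big_seq_fset1.
Qed.

Lemma l2_norm_le x (c : F) : 0 <= c ->
  (forall A : {fset I}, \sum_(i <- A) `|x i| ^+ 2 <= c ^+ 2) -> `|x| <= c.
Proof.
move=> c0 xc; rewrite -(@ler_pXn2r _ 2) ?nnegrE// l2_normsqE.
apply: has_sum_le (l2_innerP x x) _ => A.
by rewrite (eq_bigr (fun i => `|x i| ^+ 2)) ?xc// => i _; rewrite inner_norm.
Qed.

(** A Cauchy filter converges in each coordinate, because coordinates are contractions. Estimates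
    over finite index sets pass to the coordinatewise limit, which yields both its square
    summability and convergence in norm. *)
Lemma l2_complete (G : set_system l2_sum) : ProperFilter G -> cauchy G -> cvg G.
Proof.
move=> PG /cauchyP cG.
have cv i : cvg ((fun x : l2_sum => x i) @ G).
  apply: cauchy_cvg; apply: cauchy_exP => e e0.
  have [x Gx] := cG e e0; exists (x i).
  apply: (filterS (F := G) _ Gx) => z /=.
  rewrite -!ball_normE /ball_ /= => xz; apply: le_lt_trans xz.
  exact: (l2_coord_le (x - z) i).
pose y i := lim ((fun x : l2_sum => x i) @ G).
(* A finite sum depends continuously on its coordinates, so the bound valid for members of the
   filter in the ball survives at [y], uniformly in [A]. *)
have est e x : 0 < e -> G (ball x e) ->
    forall A : {fset I}, \sum_(i <- A) `|x i - y i| ^+ 2 <= e ^+ 2.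
  move=> e0 Gx A; apply: closed_le_scalar => d d0.
  have : (fun z : l2_sum => \sum_(i <- A) `|x i - z i| ^+ 2 : F^o) @ G -->
      (\sum_(i <- A) `|x i - y i| ^+ 2 : F^o).
    apply: cvg_big => [|i _]; first exact: add_continuous.
    have Gi : (fun z : l2_sum => `|x i - z i| : F^o) @ G --> (`|x i - y i| : F^o).
      by apply: cvg_norm; apply: cvgB; [exact: cvg_cst|exact: cv].
    exact: (cvgM Gi Gi).
  move=> /cvgrPdist_lt/(_ d d0) Gd.
  have [z [/= zd]] := filter_ex (filterI Gd Gx).
  rewrite -ball_normE /ball_ /= => xz; exists (\sum_(i <- A) `|x i - z i| ^+ 2) => //.
  apply: le_trans (l2_normsq_le (x - z) A) _.
  by rewrite -l2_normsqE ler_pXn2r ?nnegrE ?(ltW e0)// ltW.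
have yP : y \in l2_sum_pred Wc.
  have [x Gx] := cG 1 ltr01.
  apply/asboolP; split.
    move=> i; have /closed_linear_subspaceP[_ _] := Wc i; apply => e e0.
    have /cvgrPdist_lt/(_ e e0) Gi := cv i.
    by have [z /= yz] := filter_ex Gi; exists (z i) => //; have [] := l2_sumP z.
  (* Write [y] as [x + (y - x)]: by [normsqD_le], [x] contributes [2 * C], and the difference
     contributes [2] because the ball has radius 1. *)
  have [_ [C xC]] := l2_sumP x; exists (2 * C + 2) => A.
  apply: le_trans (_ : \sum_(i <- A) (2 * `|x i| ^+ 2 + 2 * `|x i - y i| ^+ 2) <= _).
    apply: ler_sum => i _.
    rewrite [in leLHS](_ : y i = x i + (y i - x i)); last by rewrite addrC subrK.
    by apply: le_trans (normsqD_le _ _) _; rewrite (distrC (y i)).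
  rewrite big_split /= -!mulr_sumr lerD ?ler_wpM2l//.
  by rewrite -[leRHS]mulr1 ler_wpM2l// (le_trans (est _ _ ltr01 Gx A))// expr1n.
apply/cvg_ex; exists (L2Sum yP); apply/cvgrPdist_lt => e e0.
have e20 : 0 < e / 2 by rewrite divr_gt0.
have [x Gx] := cG (e / 2) e20; apply: filterS (Gx) => z.
rewrite -ball_normE /ball_ /= => xz.
rewrite (splitr e) -[_ - z](subrKA x); apply: le_lt_trans (ler_normD _ _) _.
rewrite ler_ltD// distrC; apply: l2_norm_le (ltW e20) _ => A.
exact: est e20 Gx A.
Qed.

HB.instance Definition _ := Uniform_isComplete.Build l2_sum l2_complete.

Lemma l2_dot_normsq x : l2_dot x x = `|x| ^+ 2.
Proof. by rewrite l2_normsqE. Qed.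

HB.instance Definition _ :=
  NormedModule_hasInner.Build F conj l2_sum l2_dot_normsq.
End DirectSum.

(** * Isometries preserve inner products; linearity of projections *)

Section Isometries.
Variables (R : realType) (s : scalar_kind).
Local Notation F := (scalar_field R s).
Local Notation conj := (scalar_conj R s).
Variables V V' : hilbertType conj.

(** A polarization that serves both kinds of scalars: comparing the norms of [a *: L x + L y] and
    [a *: x + y] shows that [a * z] and [a * w] have the same real part for every [a], and
    [a = conj (z - w)] forces [z = w]. *)
Lemma isometry_inner (E : set V) (L : V -> V') : closed_subspace E ->
  (forall (a : F) x y, E x -> E y -> L (a *: x + y) = a *: L x + L y) ->
  (forall x, E x -> `|L x| = `|x|) ->
  forall x y, E x -> E y -> inner (L x) (L y) = inner x y.
Proof.
move=> Ec Llin Liso x y Ex Ey; set z := inner (L x) (L y); set w := inner x y.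
have [_ El _] := (closed_linear_subspaceP _).1 Ec.
have zw (a : F) : a * z + conj (a * z) = a * w + conj (a * w).
  have := normsqD (a *: L x) (L y); rewrite -Llin// Liso; last exact: El.
  rewrite normsqD !dotZl !normrZ !Liso// -/z -/w.
  by move=> /addrI.
have : `|z - w| ^+ 2 *+ 2 = 0.
  have dE : conj (z - w) * z = `|z - w| ^+ 2 + conj (z - w) * w.
    by rewrite -mul_scalar_conj; ring.
  have := zw (conj (z - w)); rewrite dE (rmorphD conj (`|z - w| ^+ 2)) addrACA.
  move=> /(canRL (addrK _)); rewrite subrr scalar_ge0_conj ?exprn_ge0//.
by move=> /eqP; rewrite mulrn_eq0 /= sqrf_eq0 normr_eq0 subr_eq0 => /eqP.
Qed.

Lemma linear_isometry_inner (L : {linear V -> V'}) :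
  (forall x, `|L x| = `|x|) -> forall x y, inner (L x) (L y) = inner x y.
Proof.
move=> Liso x y; apply: (@isometry_inner setT) => //; last by move=> *; exact: linearP.
by apply/closed_linear_subspaceP; split.
Qed.

Lemma proj_linear (M : set V) (a : F) x y : closed_subspace M ->
  proj M (a *: x + y) = a *: proj M x + proj M y.
Proof.
move=> Mc; have [Mx xM] := projP x Mc; have [My yM] := projP y Mc.
apply: projE => //; split.
  by have [_ Ml _] := (closed_linear_subspaceP _).1 Mc; exact: Ml.
move=> b Mb; rewrite opprD addrACA -scalerBr dotDl dotZl xM// yM//.
by rewrite mulr0 addr0.
Qed.

End Isometries.

(** * From a dilation to a Parseval fusion frame *)

Section DilationToFrame.
Variables (R : realType) (s : scalar_kind).
Local Notation F := (scalar_field R s).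
Local Notation conj := (scalar_conj R s).
Variables (H K : hilbertType conj) (I : choiceType) (W : I -> set H) (v : I -> F).
Hypothesis (W_closed : forall i, closed_subspace (W i)).
Hypothesis (v_gt0 : forall i, 0 < v i).
Variables (iota : {linear H -> K}) (E : I -> set K) (L : I -> K -> H) (P : K -> K).
Hypothesis (iota_inner : forall f g, inner (iota f) (iota g) = inner f g).
Hypothesis (E_closed : forall i, closed_subspace (E i)).
Hypothesis (E_orth : forall i j, i != j ->
  forall y z, E i y -> E j z -> inner y z = 0).
Hypothesis (E_full : closed_span (\bigcup_i E i) = setT).
Hypothesis (L_iso : forall i, isometry_onto (E i) (W i) (L i)).
Hypothesis (P_sum : forall x,
  has_sum (fun i => v i *: iota (extend0 (E i) (L i) x)) (P x)).
Hypothesis (P_proj : orthogonal_projection (range iota) P).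

(** A vector of [E i] projects to zero on every other [E j], so a single term of the series
    survives. *)
Lemma dilation_component i k : E i k -> P k = v i *: iota (L i k).
Proof.
move=> Ek; apply: (has_sum_unique (@P_sum k)).
have projEk j : proj (E j) k = if j == i then k else 0.
  apply: projE => //; case: eqVneq => [->|ji].
    by split=> // a _; rewrite subrr dot0l.
  split; first exact: closed_subspace0.
  by move=> a Ea; rewrite subr0; apply: E_orth Ek Ea; rewrite eq_sym.
have -> : v i *: iota (L i k) =
    \sum_(j <- [fset i]%fset) v j *: iota (extend0 (E j) (L j) k).
  by rewrite big_seq_fset1 /extend0 /= projEk eqxx.
apply: has_sum_finite => j; rewrite inE => ji.
rewrite /extend0 /= projEk (negPf ji).
have [_ /(_ 0) Lj _] := L_iso j.
have E0 : E j 0 by exact: closed_subspace0.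
by have /eqP := Lj E0; rewrite normr0 normr_eq0 => /eqP ->; rewrite linear0 scaler0.
Qed.

(** Let [k] be the preimage in [E i] of the projection of [f] on [W i]. For [a] in [E i], the inner
    product of [a] with [iota f] equals that of [P a] with [iota f], hence [v i] times that of
    [L i a] with [f], hence [v i] times that of [a] with [k]. So [iota f] projects to [v i *: k]. *)
Lemma dilation_norm_proj i f :
  `|proj (E i) (iota f)| = v i * `|proj (W i) f|.
Proof.
have [Llin Lnorm LW] := L_iso i.
have [Wf fW] := projP f (W_closed i).
have [k Ek Lk] : (L i @` E i) (proj (W i) f) by rewrite LW.
have -> : proj (E i) (iota f) = v i *: k.
  apply: projE => //; split; first exact: closed_subspaceZ.
  move=> a Ea; apply: inner_sym0; rewrite dotBr dotZr scalar_ge0_conj ?ltW//.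
  have [_ aP] := P_proj a.
  have : inner (a - P a) (iota f) = 0 by apply: aP; exists f.
  rewrite dotBl (dilation_component Ea) dotZl iota_inner => /eqP.
  rewrite subr_eq0 => /eqP ->.
  rewrite -(isometry_inner (E_closed i) Llin Lnorm Ea Ek) Lk -mulrBr -dotBr.
  have WLa : W i (L i a) by rewrite -LW; exists a.
  by rewrite (inner_sym0 (fW _ WLa)) mulr0.
by rewrite normrZ gtr0_norm// -Lk Lnorm.
Qed.

Lemma dilation_parseval : parseval_fusion_frame W v.
Proof.
split=> // [|f]; first by rewrite ltr01 lexx.
exists (`|f| ^+ 2); last by rewrite !mul1r lexx.
have := has_sum_normsq_proj (x := iota f) E_closed E_orth E_full.
rewrite -!inner_norm iota_inner; apply: has_sum_ext => i.
by rewrite dilation_norm_proj exprMn.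
Qed.

End DilationToFrame.

(** The orthogonal complement of a vector is a closed subspace; this is used once for each
    argument. *)
Lemma orthogonal_closed_spans (R : realType) (s : scalar_kind)
    (K : hilbertType (scalar_conj R s)) (A B : set K) :
  (forall a b, A a -> B b -> inner a b = 0) ->
  forall a b, closed_span A a -> closed_span B b -> inner a b = 0.
Proof.
move=> AB a b Aa Bb; apply: (orthogonal_closed_span (A := A)) Aa => c Ac.
by apply: inner_sym0; apply: (orthogonal_closed_span (A := B)) Bb => d Bd;
  apply: inner_sym0; exact: AB.
Qed.

(** * From a Parseval fusion frame to a dilation *)

Section FrameToDilation.
Variables (R : realType) (s : scalar_kind).
Local Notation F := (scalar_field R s).
Local Notation conj := (scalar_conj R s).
Variables (H : hilbertType conj) (I : choiceType) (W : I -> set H) (v : I -> F).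
Hypothesis (W_closed : forall i, closed_subspace (W i)).
Hypothesis (v_gt0 : forall i, 0 < v i).
Local Notation K := (l2_sum W_closed).

Lemma l2_single_mem i (w : H) : W i w ->
  (fun j => if j == i then w else 0) \in l2_sum_pred W_closed.
Proof.
move=> Ww; apply/asboolP; split=> [j|].
  by case: eqVneq => [->|_] //; exact: closed_subspace0.
exists (`|w| ^+ 2) => A.
have nE0 j : j != i -> `|if j == i then w else 0| ^+ 2 = 0.
  by move=> /negPf ->; rewrite normr0 expr0n.
have [iA|iA] := boolP (i \in A).
  by rewrite (bigD1_seq i) ?fset_uniq//= eqxx big1 ?addr0.
rewrite big_seq big1 ?exprn_ge0// => j jA; apply: nE0.
by apply: contraNneq iA => <-.
Qed.

Definition l2_single i w (Ww : W i w) : K := L2Sum (l2_single_mem Ww).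

(** The copy of [W i] inside [K], which becomes the space [E i] of the dilation. *)
Definition l2_component i : set K := [set x | forall j, j != i -> x j = 0].

Lemma l2_single_component i w (Ww : W i w) : l2_component i (l2_single Ww).
Proof. by move=> j /= /negPf ->. Qed.

Lemma l2_inner_component i (x y : K) : l2_component i y ->
  inner x y = inner (x i) (y i).
Proof.
move=> yi; apply: l2_innerE.
have -> : inner (x i) (y i) = \sum_(j <- [fset i]%fset) (inner (x j) (y j) : F^o).
  by rewrite big_seq_fset1.
by apply: has_sum_finite => j; rewrite inE => /yi ->; rewrite dot0r.
Qed.

Lemma l2_norm_component i (x : K) : l2_component i x -> `|x| = `|x i|.
Proof.
move=> xi; apply/eqP; rewrite -(@eqrXn2 _ 2)// -!inner_norm.
by rewrite (l2_inner_component x xi).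
Qed.

Lemma l2_component_closed i : closed_subspace (l2_component i).
Proof.
apply/closed_linear_subspaceP; split=> [j _ //|a x y xi yi j ji|x xi j ji].
  by rewrite l2_linE xi// yi// scaler0 addr0.
apply/eqP; rewrite -normr_le0; apply: closed_le_scalar => e /xi[a ai xa].
exists 0 => //; rewrite subr0 normr_id; apply: le_lt_trans xa.
by have := l2_coord_le (x - a) j; rewrite l2_subE (ai j ji) subr0.
Qed.

Lemma proj_l2_component i (x : K) :
  proj (l2_component i) x = l2_single ((l2_sumP x).1 i).
Proof.
apply: projE; first exact: l2_component_closed.
split=> [|a ai]; first exact: l2_single_component.
by rewrite (l2_inner_component _ ai) l2_subE /= eqxx subrr dot0l.
Qed.

Lemma l2_component_orth i j : i != j ->
  forall x y : K, l2_component i x -> l2_component j y -> inner x y = 0.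
Proof.
by move=> ij x y xi yj; rewrite (l2_inner_component _ yj) xi ?dot0l// eq_sym.
Qed.

Lemma l2_component_isometry i :
  isometry_onto (l2_component i) (W i) (fun x : K => x i).
Proof.
split=> // [x xi|]; first by rewrite (l2_norm_component xi).
rewrite eqEsubset; split=> [_ [x _ <-]|w Ww]; first exact: (l2_sumP x).1.
by exists (l2_single Ww); [exact: l2_single_component|rewrite /= eqxx].
Qed.

(** Orthonormal bases of the components are put together; the components are pairwise orthogonal, so
    the union is orthonormal and the blocks are disjoint. *)
Lemma l2_adapted_basis : exists (J : choiceType) (e : J -> K) (Ji : I -> set J),
  [/\ orthonormal_basis e, \bigcup_i Ji i = setT /\ trivIset setT Ji &
      forall i, closed_span (e @` Ji i) = l2_component i].
Proof.
have /choice[B] : forall i, exists A : set K,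
    orthonormal_set A /\ closed_span A = l2_component i.
  move=> i; have [A oA AE] := orthonormal_spanning_set (l2_component_closed i).
  by exists A.
move=> /all_and2[oB BE].
have BK i x : B i x -> l2_component i x.
  by rewrite -BE; exact: sub_closed_span.
have B1 i x : B i x -> inner x x = 1 by move=> Bx; rewrite (oB i)// eqxx.
(* The basis vectors index themselves, and [e] is the inclusion. *)
pose J := {x : K | `[< exists i, B i x >]}.
pose e : J -> K := val; pose Ji i : set J := [set j | B i (val j)].
have eJ i : e @` Ji i = B i.
  rewrite eqEsubset; split=> [_ [j Bj <-] //|x Bx].
  have xP : `[< exists i, B i x >] by apply/asboolP; exists i.
  by exists (exist _ x xP).
have BJ i k x : B i x -> B k x -> i = k.
  move=> Bi Bk; apply: contrapT => /eqP ik.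
  have := l2_component_orth ik (BK _ _ Bi) (BK _ _ Bk).
  by rewrite (B1 _ _ Bi) => /eqP; rewrite oner_eq0.
exists J, e, Ji; split; last by move=> i; rewrite eJ.
- split=> [j k|].
    have /asboolP[i Bj] := valP j; have /asboolP[i' Bk] := valP k.
    rewrite -val_eqE; have [ii'|ii'] := eqVneq i i'.
      by subst i'; exact: (oB i).
    rewrite (l2_component_orth ii' (BK _ _ Bj) (BK _ _ Bk)).
    case: eqP => // jk; case/eqP: ii'.
    by apply: BJ Bj _; rewrite jk.
  (* A vector orthogonal to the basis is orthogonal to each component, in particular to the element
     carrying its own coordinate [x i], so this coordinate vanishes. *)
  apply: closed_span_full => x xe; apply: l2_sum_inj => i.
  have xi y : l2_component i y -> inner x y = 0.
    rewrite -BE => By; apply: inner_sym0.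
    apply: (orthogonal_closed_span (A := B i)) By => b; rewrite -eJ => -[j _ <-].
    by apply: inner_sym0; apply: xe; exists j.
  have := xi _ (l2_single_component ((l2_sumP x).1 i)).
  rewrite (l2_inner_component _ (@l2_single_component _ _ _)) /= eqxx.
  by move=> /inner_eq0.
- split.
    by rewrite -subTset => j _; have /asboolP[i Bj] := valP j; exists i.
  by move=> i k _ _ [j [Bi Bk]]; exact: BJ Bi Bk.
Qed.

Hypothesis frame : parseval_fusion_frame W v.

Lemma parseval_has_sum f :
  has_sum (fun i => `|v i *: proj (W i) f| ^+ 2 : F^o) (`|f| ^+ 2).
Proof.
have [_ _ _ /(_ f)[S fS]] := frame.
rewrite !mul1r => /le_anti fS2; rewrite fS2; apply: has_sum_ext fS => i.
by rewrite normrZ exprMn gtr0_norm.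
Qed.

Lemma parseval_sum_le f (A : {fset I}) :
  \sum_(i <- A) `|v i *: proj (W i) f| ^+ 2 <= `|f| ^+ 2.
Proof.
apply: (@sum_le_has_sum R s); last exact: parseval_has_sum.
by move=> i; rewrite exprn_ge0.
Qed.

Lemma analysis_mem f : (fun i => v i *: proj (W i) f) \in l2_sum_pred W_closed.
Proof.
apply/asboolP; split=> [i|]; last first.
  by exists (`|f| ^+ 2) => A; exact: parseval_sum_le.
by apply: closed_subspaceZ => //; have [] := projP f (W_closed i).
Qed.

Definition analysis f : K := L2Sum (analysis_mem f).

Lemma analysis_linear : linear analysis.
Proof.
move=> a f g; apply: l2_sum_inj => i; rewrite l2_linE /= proj_linear//.
by rewrite scalerDr !scalerA mulrC.
Qed.
HB.instance Definition _ := GRing.isLinear.Build F H K *:%R analysis analysis_linear.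

Lemma analysis_norm f : `|analysis f| = `|f|.
Proof.
apply/eqP; rewrite -(@eqrXn2 _ 2)// -inner_norm; apply/eqP; apply: l2_innerE.
by apply: has_sum_ext (@parseval_has_sum f) => i; rewrite inner_norm.
Qed.

Lemma analysis_inner f g : inner (analysis f) (analysis g) = inner f g.
Proof. exact: (linear_isometry_inner analysis_norm). Qed.

(** The weight is real, and [x i], lying in [W i], is orthogonal to the residual of [f]. This is the
    termwise form of the adjunction between analysis and synthesis. *)
Lemma inner_analysis (x : K) f i : inner (v i *: x i) f = inner (x i) (analysis f i).
Proof.
have [_ fW] := projP f (W_closed i).
have Wx : W i (x i) by exact: (l2_sumP x).1.
rewrite /= dotZl dotZr scalar_ge0_conj ?ltW//; congr (_ * _).
apply/eqP; rewrite -subr_eq0 -dotBr; apply/eqP/inner_sym0; exact: fW.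
Qed.

(** A finite partial sum [u] satisfies a bound in terms of itself: its squared norm is the sum over
    [A] of the inner products of [x i] with [analysis u i]. Twice that is at most the sum of the
    squared norms of both, and the second part is at most the squared norm of [u], which cancels. *)
Lemma synthesis_has_sum (x : K) : exists l, has_sum (fun i => v i *: x i) l.
Proof.
have [_ [C xC]] := l2_sumP x.
apply: (@has_sum_dominated _ _ _ _ _ (fun i => `|x i| ^+ 2) C 1) => // [i|A].
  by rewrite exprn_ge0.
set u := \sum_(i <- A) _; rewrite mul1r -(lerD2r (`|u| ^+ 2)).
have uE : `|u| ^+ 2 = \sum_(i <- A) inner (x i) (analysis u i).
  rewrite -inner_norm {1}/u dot_suml; apply: eq_bigr => i _.
  exact: inner_analysis.
have {2}-> : `|u| ^+ 2 = conj (`|u| ^+ 2) by rewrite scalar_ge0_conj ?exprn_ge0.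
rewrite [in leLHS]uE rmorph_sum -big_split /=.
apply: le_trans (_ : \sum_(i <- A) (`|x i| ^+ 2 + `|analysis u i| ^+ 2) <= _).
  apply: ler_sum => i _.
  have : 0 <= `|x i - analysis u i| ^+ 2 by rewrite exprn_ge0.
  rewrite normsqD normrN -[- analysis u i]sub0r dotBr dot0r sub0r rmorphN -opprD.
  by rewrite subr_ge0.
by rewrite big_split /= lerD2l; exact: parseval_sum_le.
Qed.

Definition synthesis (x : K) : H := sval (cid (synthesis_has_sum x)).

Lemma synthesisP (x : K) : has_sum (fun i => v i *: x i) (synthesis x).
Proof. exact: svalP (cid _). Qed.

Lemma synthesis_adjoint (x : K) f : inner (synthesis x) f = inner x (analysis f).
Proof.
apply/esym/l2_innerE; apply: has_sum_ext (has_sum_inner f (@synthesisP x)) => i.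
exact: inner_analysis.
Qed.

(** Against [analysis f], both [x] and its image have the inner product of [synthesis x] with [f],
    since [analysis] is an isometry with adjoint [synthesis]. *)
Lemma analysis_synthesis_projection :
  orthogonal_projection (range analysis) (analysis \o synthesis).
Proof.
move=> x; split; first by exists (synthesis x).
move=> _ [f _ <-]; rewrite dotBl /= analysis_inner synthesis_adjoint subrr//.
Qed.

Lemma analysis_synthesis_has_sum (x : K) :
  has_sum (fun i => v i *: analysis (x i)) (analysis (synthesis x)).
Proof.
have nle f : `|analysis f| <= 1 * `|f| by rewrite mul1r analysis_norm.
apply: has_sum_ext (has_sum_map (raddfB analysis) ler01 nle (@synthesisP x)) => i.
by rewrite /= linearZ.
Qed.

Lemma parseval_dilation :
  exists (K : hilbertType conj) (iota : {linear H -> K})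
         (J : choiceType) (e : J -> K) (Ji : I -> set J)
         (L : I -> K -> H) (P : K -> K),
    let E i := closed_span (e @` Ji i) in
    [/\ forall f g : H, inner (iota f) (iota g) = inner f g,
        orthonormal_basis e,
        \bigcup_i Ji i = setT /\ trivIset setT Ji,
        forall i, isometry_onto (E i) (W i) (L i) &
        (forall x, has_sum (fun i => v i *: iota (extend0 (E i) (L i) x)) (P x)) /\
        orthogonal_projection (range iota) P].
Proof.
have [J [e [Ji [onb part JE]]]] := l2_adapted_basis.
exists K, analysis, J, e, Ji, (fun i (x : K) => x i), (analysis \o synthesis) => E.
have EE i : E i = l2_component i by exact: JE.
split=> //; first exact: analysis_inner.
  by move=> i; rewrite EE; exact: l2_component_isometry.
split; last exact: analysis_synthesis_projection.
(* Projecting on component [i] keeps coordinate [i], so the extension of [L i] by zero is evaluation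
   at [i] on all of [K]. *)
move=> x; apply: has_sum_ext (@analysis_synthesis_has_sum x) => i.
by rewrite EE /extend0 /= proj_l2_component /= eqxx.
Qed.

End FrameToDilation.

Theorem theorem2p1 (R : realType) (s : scalar_kind)
    (H : hilbertType (scalar_conj R s))
    (I : choiceType) (W : I -> set H) (v : I -> scalar_field R s)
    (W_closed : forall i, closed_subspace (W i))
    (W_complete : complete_family W)
    (v_gt0 : forall i, 0 < v i) :
  parseval_fusion_frame W v <->
  exists (K : hilbertType (scalar_conj R s))
         (iota : {linear H -> K})
         (J : choiceType) (e : J -> K) (Ji : I -> set J)
         (L : I -> K -> H) (P : K -> K),
    let E i := closed_span (e @` Ji i) in
    [/\ forall f g : H, inner (iota f) (iota g) = inner f g,
        orthonormal_basis e,
        \bigcup_i Ji i = setT /\ trivIset setT Ji,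
        forall i, isometry_onto (E i) (W i) (L i) &
        (forall x, has_sum (fun i => v i *: iota (extend0 (E i) (L i) x)) (P x)) /\
        orthogonal_projection (range iota) P].
Proof.
split; first exact (parseval_dilation W_closed v_gt0).
move=> [K [iota [J [e [Ji [L [P]]]]]]].
move=> [iota_inner [e_orth e_full] [JiT Ji_triv] L_iso [P_sum P_proj]].
apply: (dilation_parseval W_closed v_gt0 iota_inner _ _ _ L_iso P_sum P_proj).
- by move=> i; exact: closed_span_closed.
(* Basis vectors from disjoint blocks have distinct indices, hence are orthogonal, and this extends
   to the closed spans. *)
- move=> i j ij; apply: orthogonal_closed_spans => _ _ [k Jk <-] [l Jl <-].
  rewrite e_orth; case: eqP => // kl; case/eqP: ij.
  by apply: Ji_triv => //; exists k; split=> //; rewrite kl.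
- rewrite -subTset -e_full; apply: closed_span_min; first exact: closed_span_closed.
  move=> _ [j _ <-]; apply: sub_closed_span.
  have [i _ Jij] : (\bigcup_i Ji i) j by rewrite JiT.
  by exists i => //; apply: sub_closed_span; exists j.
Qed.
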